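(* Let $\widetilde{G}$ be a connected mixed graph with pendant vertices. Then $p(\widetilde{G})=2$ if and only if $\widetilde{G}$ is obtained by adding some undirected edges (possibly none) and some directed edges (possibly none, with arbitrary directions) between the center of a mixed star and some vertices of a mixed graph $\widetilde{F}$, where $\widetilde{F}$ is switching equivalent either to a complete multipartite graph or to some $\overrightarrow{C_3}(t_1,t_2,t_3)$.
   Context: A mixed graph $\widetilde{G}$ is obtained from a simple graph $G$ (its underlying graph) by orienting some of its edges (these become arcs); the remaining edges stay undirected. A simple graph is regarded as a mixed graph with no arcs. If $V(G)=\{v_1,\dots,v_n\}$, the Hermitian adjacency matrix $H(\widetilde{G})=(h_{st})$ has $h_{st}=1$ if $v_sv_t$ is an undirected edge, $h_{st}=i$ if there is an arc from $v_s$ to $v_t$, $h_{st}=-i$ if there is an arc from $v_t$ to $v_s$, and $h_{st}=0$ otherwise ($i=\sqrt{-1}$). The positive inertia index $p(\widetilde{G})$ is the number of positive eigenvalues of $H(\widetilde{G})$ counted with multiplicity. A pendant vertex is a vertex of degree one in the underlying graph. A mixed star is a mixed graph whose underlying graph is a star; its center is the vertex of the star adjacent to all others. The converse of a mixed graph is obtained by reversing all its arcs. Two mixed graphs $\widetilde{G_1},\widetilde{G_2}$ (on a common, suitably identified vertex set) are switching equivalent if there is a diagonal matrix $Q$ with diagonal entries in $\{\pm1,\pm i\}$ such that $H(\widetilde{G_2})=Q^{-1}H(\widetilde{G_1})Q$ or $H(\widetilde{G_2})^{\top}=Q^{-1}H(\widetilde{G_1})Q$ (i.e. $\widetilde{G_1}$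 is changed into $\widetilde{G_2}$ by such a diagonal similarity, possibly followed by taking the converse). For positive integers $t_1,t_2,t_3$, $\overrightarrow{C_3}(t_1,t_2,t_3)$ is the mixed complete tripartite graph with parts $A,B,C$, $|A|=t_1,|B|=t_2,|C|=t_3$, in which every edge between $A$ and $B$ is an arc from $A$ to $B$, every edge between $B$ and $C$ is an arc from $B$ to $C$, and every edge between $C$ and $A$ is an arc from $C$ to $A$. *)

(* Defs.v *)
From HB Require Import structures.
From mathcomp Require Import all_boot all_order all_algebra.

Set Implicit Arguments.
Unset Strict Implicit.
Unset Printing Implicit Defensive.

Import Order.TTheory GRing.Theory Num.Theory.

Local Open Scope ring_scope.

Record simple_graph (V : finType) := SimpleGraph {
  sadj : rel V;
  sadj_sym : symmetric sadj;
  sadj_irr : irreflexive sadj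
}.

(* The arcs are the edges of the underlying graph that received an
   orientation; the other edges stay undirected. *)
Record mixed_graph (V : finType) := MixedGraph {
  underlying : simple_graph V;
  arc : rel V;
  arc_sub : forall x y, arc x y -> sadj underlying x y;
  arc_asym : forall x y, arc x y -> ~~ arc y x
}.

Definition adj (V : finType) (G : mixed_graph V) : rel V :=
  sadj (underlying G).

Definition undirected (V : finType) (G : mixed_graph V) (x y : V) : bool :=
  [&& adj G x y, ~~ arc G x y & ~~ arc G y x].

Definition mixed_of_simple (V : finType) (G : simple_graph V) : mixed_graph V :=
  @MixedGraph V G (fun _ _ => false)
    (fun x y (h : false) => False_ind (sadj G x y) (notF h))
    (fun _ _ _ => isT).

Coercion mixed_of_simple : simple_graph >-> mixed_graph.

Definition hermitian_entry (C : numClosedFieldType) (V : finType)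
    (G : mixed_graph V) (x y : V) : C :=
  if undirected G x y then 1
  else if arc G x y then 'i
  else if arc G y x then - 'i
  else 0.

Definition hermitian_adj (C : numClosedFieldType) (V : finType)
    (G : mixed_graph V) : 'M[C]_#|V| :=
  \matrix_(s, t) hermitian_entry C G (enum_val s) (enum_val t).

(* The roots of the characteristic polynomial, repeated according to their
   multiplicity. *)
Definition eigenvalue_seq (C : numClosedFieldType) (n : nat) (A : 'M[C]_n) :
    seq C :=
  sval (closed_field_poly_normal (char_poly A)).

(* In a numClosedFieldType, 0 < x forces x to be real. *)
Definition positive_inertia (C : numClosedFieldType) (V : finType)
    (G : mixed_graph V) : nat :=
  count (fun x : C => 0 < x) (eigenvalue_seq (hermitian_adj C G)).

Definition connected_graph (V : finType) (G : mixed_graph V) : Prop :=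
  forall x y : V, connect (adj G) x y.

Definition pendant (V : finType) (G : mixed_graph V) (x : V) : Prop :=
  #|[set y | adj G x y]| = 1%N.

(* A star has at least one edge; in a star with exactly one edge either end
   may serve as the center. *)
Definition mixed_star (V : finType) (S : mixed_graph V) (c : V) : Prop :=
  (2 <= #|V|)%N /\
  forall x y : V, adj S x y = (x != y) && ((x == c) || (y == c)).

(* Up to the identification f of the vertex set of G with the disjoint union
   of those of S and F, G is S and F together with arbitrary undirected edges
   or arcs, each of which joins c to a vertex of F. *)
Definition joined_at (V VS VF : finType) (G : mixed_graph V)
    (S : mixed_graph VS) (c : VS) (F : mixed_graph VF) : Prop :=
  exists f : VS + VF -> V,
    [/\ bijective f,
        forall x y, adj G (f (inl x)) (f (inl y)) = adj S x y
                 /\ arc G (f (inl x)) (f (inl y)) = arc S x y,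
        forall x y, adj G (f (inr x)) (f (inr y)) = adj F x y
                 /\ arc G (f (inr x)) (f (inr y)) = arc F x y
      & forall x y, adj G (f (inl x)) (f (inr y)) -> x = c].

Definition switching_equivalent (C : numClosedFieldType) (V : finType)
    (G1 G2 : mixed_graph V) : Prop :=
  exists Q : 'M[C]_#|V|,
    [/\ is_diag_mx Q,
        forall s, Q s s \in [:: 1; -1; 'i; - 'i]
      & hermitian_adj C G2 = invmx Q *m hermitian_adj C G1 *m Q
     \/ (hermitian_adj C G2)^T = invmx Q *m hermitian_adj C G1 *m Q].

(* At least two parts, all of them nonempty. *)
Definition complete_multipartite (V : finType) (K : simple_graph V) : Prop :=
  exists (k : nat) (part : V -> 'I_k),
    [/\ (2 <= k)%N,
        forall j, exists x, part x = j
      & forall x y, sadj K x y = (part x != part y)].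

Definition directed_C3 (t1 t2 t3 : nat) (V : finType) (K : mixed_graph V) :
    Prop :=
  exists A B D : {set V},
    [/\ [/\ #|A| = t1, #|B| = t2 & #|D| = t3],
        [/\ [disjoint A & B], [disjoint B & D] & [disjoint D & A]],
        A :|: B :|: D = [set: V],
        forall x y, arc K x y = [|| (x \in A) && (y \in B),
                                    (x \in B) && (y \in D)
                                  | (x \in D) && (y \in A)]
      & forall x y, adj K x y = arc K x y || arc K y x].

(* Main.v *)
Require Import Defs.
From mathcomp Require Import all_boot all_order all_algebra.
From mathcomp Require Import ring.

(** The positive inertia p(A) of a Hermitian matrix never increases under
    A |-> P A P^*, for P of any shape, so it is additive along Schur
    complements. For an edge ab of a graph this gives p(H) = 1 + p(S), where
    S_xy = h_xy - h_xa h_ab h_by - h_xb h_ba h_ay.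
    If a is pendant at b, then S is the matrix of the graph without the edges
    at b; as G is connected, this leaves isolated vertices, which form a star
    with b, and a graph F with p(F) = 1.
    For an edge ab of F, S is negative semidefinite. Rescale every vertex by a
    fourth root of unity to normalise its entries at a and b. A vertex adjacent
    to both then carries one parameter t, the weight of its triangle with ab;
    S_xx <= 0 excludes t = -1. If t = i or -i then S_xx = 0, so the row of S at
    x vanishes; this forces the same t at all such vertices and gives a
    directed C3. If t = 1 throughout, the 2x2 and 3x3 minors of S make
    non-adjacency an equivalence relation. *)

Section PositiveInertia.

Set Implicit Arguments.
Unset Strict Implicit.
Unset Printing Implicit Defensive.

Import Order.TTheory GRing.Theory Num.Theory.
(* Makes [arc] denote the arcs of a mixed graph again, not [path.arc]. *)
Import Defs.

Local Open Scope ring_scope.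
Local Open Scope sesquilinear_scope.

Variable C : numClosedFieldType.

(** * Inertia of Hermitian matrices *)

Definition inertia n (A : 'M[C]_n) : nat :=
  count (fun x : C => 0 < x) (eigenvalue_seq A).

Lemma eigenvalue_seqE n (A : 'M[C]_n) (s : seq C) :
  char_poly A = \prod_(x <- s) ('X - x%:P) -> perm_eq (eigenvalue_seq A) s.
Proof.
move=> As; apply: prod_XsubC_eq; rewrite -As /eigenvalue_seq.
case: closed_field_poly_normal => r /= ->.
by rewrite (monicP (char_poly_monic A)) scale1r.
Qed.

Lemma eigenvalue_prod n (A : 'M[C]_n) :
  char_poly A = \prod_(x <- eigenvalue_seq A) ('X - x%:P).
Proof.
rewrite /eigenvalue_seq; case: closed_field_poly_normal => r /=.
by rewrite (monicP (char_poly_monic A)) scale1r.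
Qed.

Lemma inertia_char_poly m n (A : 'M[C]_m) (B : 'M[C]_n) :
  char_poly A = char_poly B -> inertia A = inertia B.
Proof.
move=> AB; apply/permP; apply: eigenvalue_seqE.
by rewrite AB eigenvalue_prod.
Qed.

Lemma inertia_trmx n (A : 'M[C]_n) : inertia A^T = inertia A.
Proof.
apply: inertia_char_poly; rewrite /char_poly -det_tr; congr (\det _).
by apply/matrixP=> i j; rewrite !mxE eq_sym.
Qed.

Lemma inertia_block_diag m n (A : 'M[C]_m) (B : 'M[C]_n) :
  inertia (block_mx A 0 0 B) = (inertia A + inertia B)%N.
Proof.
rewrite /inertia -count_cat; apply/permP; apply: eigenvalue_seqE.
rewrite big_cat /= -!eigenvalue_prod /char_poly -[RHS](det_lblock _ 0).
congr (\det _); rewrite /char_poly_mx map_block_mx !map_mx0.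
by rewrite scalar_mx_block opp_block_mx add_block_mx !oppr0 !addr0.
Qed.

Lemma inertia_scalar (a : C) : inertia (a%:M : 'M_1) = (0 < a)%R :> nat.
Proof.
rewrite /inertia (permP (@eigenvalue_seqE _ _ [:: a] _)) /= ?addn0//.
by rewrite big_seq1 /char_poly det_mx11 !mxE.
Qed.

Lemma inertia_diag n (d : 'rV[C]_n) :
  inertia (diag_mx d) = #|[pred i | 0 < d 0 i]|.
Proof.
rewrite /inertia (permP (@eigenvalue_seqE _ _ [seq d 0 i | i <- enum 'I_n] _)).
  rewrite count_map -size_filter cardE; congr size.
  by rewrite enumT; apply: eq_filter.
rewrite big_map big_enum char_poly_trig; last exact: diag_mx_is_trig.
by apply: eq_bigr => i _; rewrite mxE eqxx.
Qed.

Lemma char_poly_mulV n (V U D : 'M[C]_n) : V *m U = 1%:M -> 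
 char_poly (V *m D *m U) = char_poly D.
Proof.
move=> VU; rewrite /char_poly /char_poly_mx !map_mxM.
set v := map_mx _ V; set u := map_mx _ U; set d := map_mx _ D.
have vu : v *m u = 1%:M by rewrite -map_mxM VU map_mx1.
have -> : 'X%:M - v *m d *m u = v *m ('X%:M - d) *m u.
  by rewrite mulmxBr mulmxBl scalar_mxC -['X%:M *m _ *m _]mulmxA vu mulmx1.
by rewrite !det_mulmx mulrAC -det_mulmx vu det1 mul1r.
Qed.

Lemma trmxC_mul m n p (A : 'M[C]_(m, n)) (B : 'M[C]_(n, p)) :
  (A *m B)^t* = B^t* *m A^t*.
Proof. by rewrite trmx_mul map_mxM. Qed.

Lemma hermitian_spectral n (A : 'M[C]_n) : A^t* = A ->
  exists (U : 'M[C]_n) (d : 'rV[C]_n),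
    [/\ U *m U^t* = 1%:M, forall i, d 0 i \is Num.real,
        A = U^t* *m diag_mx d *m U & inertia A = #|[pred i | 0 < d 0 i]|].
Proof.
move=> hA; have hermA : A \is hermsymmx.
  by apply/is_hermitianmxP; rewrite expr0 scale1r hA.
have /orthomx_spectralP := hermitian_normalmx hermA.
set U := spectralmx A; set d := spectral_diag A => Ad.
have uU : U \is unitarymx := spectral_unitarymx A.
exists U, d; split.
- exact/unitarymxP.
- by move=> i; have /mxOverP := hermitian_spectral_diag_real hermA; apply.
by rewrite -invmx_unitary.
rewrite -inertia_diag; apply: inertia_char_poly.
by have := char_poly_mulV (diag_mx d) (mulVmx (unitarymx_unit uU)); rewrite -Ad.
Qed.

Lemma diag_formE n (d v : 'rV[C]_n) :
  v *m diag_mx d *m v^t* = (\sum_i d 0 i * `|v 0 i| ^+ 2)%:M.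
Proof.
rewrite [LHS]mx11_scalar; congr _%:M; rewrite mxE; apply: eq_bigr => i _.
by rewrite mul_mx_diag !mxE normCK mulrAC mulrC.
Qed.

Lemma pos_diag_le m n (W : 'M[C]_(m, n)) (d : 'rV_n) (d' : 'rV_m) :
  (forall i, d 0 i \is Num.real) -> W *m diag_mx d *m W^t* = diag_mx d' ->
  (#|[pred i | (0 < d' 0 i)%R]| <= #|[pred i | (0 < d 0 i)%R]|)%N.
Proof.
set K' := [pred i | _]; set K := [pred i | _] => dr Wd; rewrite leqNgt.
apply/negP => ltK.
pose e' (i : 'I_#|K'|) : 'I_m := enum_val i.
pose e (i : 'I_#|K|) : 'I_n := enum_val i.
pose M := mxsub e' e W.
have : kermx M != 0.
  rewrite kermx_eq0 /row_free -[_ == _]negbK; apply/negP; rewrite negbK => /eqP rM.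
  by have := rank_leq_col M; rewrite rM leqNgt ltK.
rewrite -nz_row_eq0; set z := nz_row _ => z0.
have zM : z *m M = 0 by apply/sub_kermxP/nz_row_sub.
pose y := z *m rowsub e' W.
have y0 i : 0 < d 0 i -> y 0 i = 0.
  move=> di; transitivity ((z *m M) 0 (enum_rank_in di i)); last by rewrite zM mxE.
  by rewrite !mxE; apply: eq_bigr => j _; rewrite !mxE /e enum_rankK_in.
have yz : y *m diag_mx d *m y^t* = z *m diag_mx (colsub e' d') *m z^t*.
  have -> : diag_mx (colsub e' d') = rowsub e' W *m diag_mx d *m (rowsub e' W)^t*.
    have -> : (rowsub e' W)^t* = colsub e' (W^t*).
      by apply/matrixP=> i j; rewrite !mxE.
    rewrite mul_rowsub_mx mulmx_colsub mul_rowsub_mx Wd.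
    by apply/matrixP=> i j; rewrite !mxE (inj_eq enum_val_inj).
  by rewrite /y trmxC_mul !mulmxA.
move: yz; rewrite !diag_formE => /matrixP/(_ 0 0); rewrite !mxE eqxx !mulr1n => yz.
have /lt_geF : 0 < \sum_i colsub e' d' 0 i * `|z 0 i| ^+ 2.
  have /rV0Pn[j zj] := z0.
  rewrite (bigD1 j) //= ltr_pwDl //.
    rewrite mulr_gt0 ?exprn_gt0 ?normr_gt0 // mxE.
    by have := enum_valP j; rewrite inE.
  apply: sumr_ge0 => i _; rewrite mulr_ge0 ?exprn_ge0 // mxE.
  by apply: ltW; have := enum_valP i; rewrite inE.
case/negP; rewrite -yz; apply: sumr_le0 => i _.
have [di|di] := real_ltP (real0 C) (dr i).
  by rewrite y0 // normr0 expr0n mulr0.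
by rewrite mulr_le0_ge0 ?exprn_ge0.
Qed.

Lemma inertia_congr m n (P : 'M[C]_(m, n)) (A : 'M[C]_n) :
  A^t* = A -> (inertia (P *m A *m P^t*) <= inertia A)%N.
Proof.
move=> hA; set B := P *m A *m P^t*.
have hB : B^t* = B by rewrite /B !trmxC_mul trmxCK hA mulmxA.
have [U [d [UU dr Ad ->]]] := hermitian_spectral hA.
have [V [d' [VV d'r Bd ->]]] := hermitian_spectral hB.
apply: (@pos_diag_le _ _ (V *m P *m U^t*)) => //.
rewrite !trmxC_mul trmxCK.
transitivity (V *m B *m V^t*); first by rewrite /B Ad !mulmxA.
by rewrite Bd !mulmxA VV mul1mx -mulmxA VV mulmx1.
Qed.

Lemma inertiaD n (A B : 'M[C]_n) : A^t* = A -> B^t* = B ->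
  (inertia (A + B) <= inertia A + inertia B)%N.
Proof.
move=> hA hB; rewrite -inertia_block_diag.
have -> : A + B = row_mx 1%:M 1%:M *m block_mx A 0 0 B *m (row_mx 1%:M 1%:M)^t*.
  rewrite tr_row_mx map_col_mx mul_row_block mul_row_col !trmx1 !map_mx1.
  by rewrite !mulmx0 !mulmx1 !mul1mx addr0 add0r.
apply: inertia_congr.
by rewrite tr_block_mx map_block_mx hA hB !trmx0 !map_mx0.
Qed.

Lemma inertia_NSD n (A : 'M[C]_n) (v : 'rV[C]_n) : A^t* = A ->
  inertia A = 0 -> (v *m A *m v^t*) 0 0 <= 0.
Proof.
move=> hA A0; have := inertia_congr v hA; rewrite A0 leqn0.
set q := v *m A *m v^t*.
have qr : q 0 0 \is Num.real.
  apply/CrealP; have /matrixP/(_ 0 0) : q^t* = q.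
    by rewrite /q !trmxC_mul trmxCK hA mulmxA.
  by rewrite !mxE.
rewrite [q in inertia q]mx11_scalar inertia_scalar eqb0.
by rewrite (real_ltNge (real0 _) qr) negbK.
Qed.

(* The congruence by [col_mx N P], where P = 1 - A N^* E' N, splits A. *)
Lemma inertia_schur k n (N : 'M[C]_(k, n)) (A : 'M[C]_n) (E' : 'M[C]_k) :
  A^t* = A -> E' *m (N *m A *m N^t*) = 1%:M ->
  inertia A = (inertia (N *m A *m N^t*)
               + inertia (A - A *m N^t* *m E' *m N *m A))%N.
Proof.
move=> hA; set E := N *m A *m N^t* => E'E.
have hE : E^t* = E by rewrite /E !trmxC_mul trmxCK hA mulmxA.
have EE' : E *m E' = 1%:M by apply: mulmx1C.
have hE' : E'^t* = E'.
  rewrite -[LHS]mulmx1 -EE' mulmxA -{1}hE -trmxC_mul EE' trmx1 map_mx1 mul1mx //.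
set S := A - _.
have hS : S^t* = S.
  rewrite /S linearB /= map_mxB hA; congr (_ - _).
  by rewrite !trmxC_mul trmxCK hA hE' !mulmxA.
have NS : N *m S = 0.
  by rewrite /S mulmxBr !mulmxA -/E EE' mul1mx subrr.
have SN : S *m N^t* = 0.
  by rewrite -[S]hS -trmxC_mul NS trmx0 map_mx0.
have hD : (block_mx E 0 0 S)^t* = block_mx E 0 0 S.
  by rewrite tr_block_mx map_block_mx hE hS !trmx0 !map_mx0.
apply/eqP; rewrite eqn_leq -inertia_block_diag; apply/andP; split.
  have {1}-> : A = row_mx (A *m N^t* *m E') 1%:M *m block_mx E 0 0 S
       *m (row_mx (A *m N^t* *m E') 1%:M)^t*.
    rewrite tr_row_mx map_col_mx mul_row_block mul_row_col !trmx1 !map_mx1.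
    rewrite !mulmx0 !mulmx1 !mul1mx addr0 add0r !trmxC_mul trmxCK hA hE'.
    by rewrite -[A *m _ *m E' *m E]mulmxA E'E mulmx1 !mulmxA /S addrC subrK.
  exact: inertia_congr.
pose P := 1%:M - A *m N^t* *m E' *m N.
have PA : P *m A = S by rewrite /P mulmxBl mul1mx.
have -> : block_mx E 0 0 S = col_mx N P *m A *m (col_mx N P)^t*.
  rewrite tr_col_mx map_row_mx mul_col_mx mul_col_row -/E PA SN; congr block_mx.
    by rewrite -mulmxA -{1}hA -trmxC_mul PA hS NS.
  rewrite /P linearB /= map_mxB trmx1 map_mx1 mulmxBr mulmx1 !trmxC_mul !mulmxA.
  by rewrite SN !mul0mx subr0.
exact: inertia_congr.
Qed.

(** * Hermitian forms on a finite type *)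

Lemma trmxC_rowsub1 m n (g : 'I_m -> 'I_n) :
  (rowsub g 1%:M)^t* = colsub g 1%:M :> 'M[C]_(n, m).
Proof. by apply/matrixP=> i j; rewrite !mxE eq_sym conjC_nat. Qed.

Lemma mxsub_congr m n (g : 'I_m -> 'I_n) (A : 'M[C]_n) :
  mxsub g g A = rowsub g 1%:M *m A *m (rowsub g 1%:M)^t*.
Proof.
rewrite trmxC_rowsub1 mul_rowsub_mx mulmx_colsub mul1mx mulmx1.
by apply/matrixP=> i j; rewrite !mxE.
Qed.

Lemma inertia_mxsub m n (g : 'I_m -> 'I_n) (A : 'M[C]_n) : A^t* = A ->
  (inertia (mxsub g g A) <= inertia A)%N.
Proof. by rewrite mxsub_congr; apply: inertia_congr. Qed.

Definition form_mx (V : finType) (h : V -> V -> C) : 'M[C]_#|V| :=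
  \matrix_(s, t) h (enum_val s) (enum_val t).

Definition form_inertia (V : finType) (h : V -> V -> C) := inertia (form_mx h).

Definition hermitian_form (V : finType) (h : V -> V -> C) :=
  forall x y, h y x = (h x y)^*.

Lemma form_mx_herm (V : finType) (h : V -> V -> C) :
  hermitian_form h -> (form_mx h)^t* = form_mx h.
Proof. by move=> hh; apply/matrixP=> i j; rewrite !mxE -hh. Qed.

Lemma eq_form_inertia (V : finType) (h k : V -> V -> C) :
  h =2 k -> form_inertia h = form_inertia k.
Proof.
by move=> hk; congr inertia; apply/matrixP=> i j; rewrite !mxE hk.
Qed.

Lemma form_inertia0 (V : finType) : form_inertia (fun _ _ : V => 0) = 0%N.
Proof.
have -> : form_inertia (fun _ _ : V => 0) = inertia (diag_mx (0 : 'rV[C]_#|V|)).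
  by congr inertia; apply/matrixP=> i j; rewrite !mxE mul0rn.
rewrite inertia_diag; apply: eq_card0 => i.
by rewrite inE mxE ltxx.
Qed.

Lemma form_inertia_pull (V W : finType) (h : V -> V -> C) (f : W -> V)
    (d : W -> C) : hermitian_form h ->
  (form_inertia (fun x y => d x * (d y)^* * h (f x) (f y))%R <= form_inertia h)%N.
Proof.
move=> hh.
pose g (i : 'I_#|W|) : 'I_#|V| := enum_rank (f (enum_val i)).
pose D := diag_mx (\row_i d (@enum_val W W i)) : 'M[C]_#|W|.
have -> : form_inertia (fun x y => d x * (d y)^* * h (f x) (f y))
        = inertia (D *m mxsub g g (form_mx h) *m D^t*).
  congr inertia; rewrite tr_diag_mx map_diag_mx mul_diag_mx mul_mx_diag.
  by apply/matrixP=> i j; rewrite !mxE !enum_rankK mulrAC.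
apply: leq_trans (inertia_mxsub g (form_mx_herm hh)).
apply: inertia_congr.
by apply/matrixP=> i j; rewrite !mxE -hh.
Qed.

Lemma inertia_anti_diag (w : C) : `|w| = 1 ->
  inertia (\matrix_(i < 2, j < 2) (if i == j then 0 else if i == 0 then w else w^*))
    = 1%N.
Proof.
move=> w1; rewrite /inertia (permP (@eigenvalue_seqE _ _ [:: 1; -1] _)) /=.
  by rewrite ltr01 ltr0N1 .
rewrite big_cons big_seq1 /char_poly (expand_det_row _ 0).
rewrite !big_ord_recl big_ord0 /cofactor !det_mx11 !mxE /=.
rewrite !mulr0n !mulr1n !sub0r /bump /= addn0 expr0 expr1.
have := normCK w; rewrite w1 expr1n => ww.
rewrite polyC0 polyCN mulN1r !opprK mulNr -polyCM -ww.
by ring.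
Qed.

Lemma form_inertia_edge (V : finType) (h : V -> V -> C) (a b : V) :
  hermitian_form h -> h a a = 0 -> h b b = 0 -> `|h a b| = 1 ->
  form_inertia h =
  (form_inertia (fun x y =>
     h x y - (h x a * h a b * h b y + h x b * h b a * h a y))).+1.
Proof.
move=> hh aa bb ab; pose A := form_mx h.
pose g (i : 'I_2) : 'I_#|V| := enum_rank (if i == 0 then a else b).
pose N := rowsub g 1%:M : 'M[C]_(2, #|V|).
pose E := \matrix_(i < 2, j < 2)
  (if i == j then 0 else if i == 0 then h a b else (h a b)^* : C).
have EA : N *m A *m N^t* = E.
  rewrite -mxsub_congr; apply/matrixP=> i j; rewrite !mxE !enum_rankK.
  by move: i j => [[|[|//]] ?] [[|[|//]] ?]; rewrite ?aa ?bb //= hh.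
have EE : E *m E = 1%:M.
  apply/matrixP=> i j; rewrite !mxE big_ord_recl big_ord1 !mxE.
  have := normCK (h a b); rewrite ab expr1n => ww.
  by move: i j => [[|[|//]] ?] [[|[|//]] ?];
    rewrite /= ?mulr0 ?mul0r ?addr0 ?add0r -?ww // mulrC.
have := @inertia_schur _ _ N A E (form_mx_herm hh).
rewrite EA EE inertia_anti_diag // => /(_ erefl) sch.
rewrite /form_inertia -/A sch add1n; congr (inertia _).+1.
rewrite trmxC_rowsub1 mulmx_colsub mulmx1 -mulmxA mul_rowsub_mx mul1mx.
apply/matrixP=> i j; rewrite !mxE; congr (_ - _).
rewrite !big_ord_recl !big_ord0 !mxE /= !big_ord_recl !big_ord0 !mxE /= !enum_rankK.
rewrite -hh; ring.
Qed.

Lemma form_NSD3 (V : finType) (h : V -> V -> C) (x y z : V) (a b c : C) :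
  hermitian_form h -> form_inertia h = 0%N ->
  a * h x x * a^* + a * h x y * b^* + a * h x z * c^*
  + (b * h y x * a^* + b * h y y * b^* + b * h y z * c^*)
  + (c * h z x * a^* + c * h z y * b^* + c * h z z * c^*) <= 0.
Proof.
move=> hh h0.
pose g (i : 'I_3) : 'I_#|V| := enum_rank (tnth [tuple x; y; z] i).
pose v := \row_i tnth [tuple a; b; c] i : 'rV[C]_3.
have hg : (mxsub g g (form_mx h))^t* = mxsub g g (form_mx h).
  by apply/matrixP=> i j; rewrite !mxE -hh.
have := @inertia_NSD _ (mxsub g g (form_mx h)) v hg.
have -> : inertia (mxsub g g (form_mx h)) = 0%N.
  apply/eqP; rewrite -leqn0; have := inertia_mxsub g (form_mx_herm hh).
  by rewrite -/(form_inertia h) h0.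
move=> /(_ erefl); rewrite !mxE.
rewrite !big_ord_recl !big_ord0 !mxE !big_ord_recl !big_ord0 !mxE !enum_rankK.
rewrite !(tnth_nth a) !(tnth_nth x) /=.
by apply: le_trans; rewrite le_eqVlt; apply/orP; left; apply/eqP; ring.
Qed.

Lemma form_NSD_diag (V : finType) (h : V -> V -> C) x :
  hermitian_form h -> form_inertia h = 0%N -> h x x <= 0.
Proof.
move=> hh h0; have := form_NSD3 x x x 1 0 0 hh h0.
by rewrite conjC0 conjC1 !(mul0r, mulr0, addr0, mulr1, mul1r).
Qed.

Lemma form_NSD_row0 (V : finType) (h : V -> V -> C) x y :
  hermitian_form h -> form_inertia h = 0%N -> h x x = 0 -> h x y = 0.
Proof.
move=> hh h0 xx; apply/eqP; apply: contraT => xy.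
have m0 : h x y * (h x y)^* != 0 by rewrite mulf_neq0 ?conjC_eq0.
have yr : (h y y)^* = h y y by rewrite -hh.
pose s := (1 - h y y) / (h x y * (h x y)^* + h x y * (h x y)^*).
have sr : s^* = s.
  rewrite /s rmorphM fmorphV !rmorphD rmorphN !rmorphM /= conjC1 yr conjCK.
  by rewrite [_^* * _]mulrC.
have := form_NSD3 x y y (s * (h x y)^*) 1 0 hh h0.
rewrite conjC0 conjC1 xx !(mul0r, mulr0, addr0, mulr1, mul1r, add0r).
rewrite rmorphM /= conjCK sr [h y x]hh.
have -> : s * (h x y)^* * h x y + ((h x y)^* * (s * h x y) + h y y) = 1.
  rewrite /s; field.
  by rewrite -mulr2n mulrn_eq0 /= (negPf m0).
by rewrite ler10.
Qed.

Definition unit4 (x : C) := x \in [:: 1; -1; 'i; - 'i].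

Lemma unit4P (x : C) : reflect (x ^+ 4 = 1) (unit4 x).
Proof.
rewrite /unit4 !inE; apply: (iffP idP) => [|x4].
  by case/or4P=> /eqP ->; rewrite ?expr1n // -[4%N]/(2 * 2)%N exprM ?sqrrN;
    rewrite ?sqrCi ?sqrrN ?expr1n.
have : (x - 1) * (x - -1) * ((x - 'i) * (x - - 'i)) = 0.
  rewrite -(subrr 1) -[X in _ = X - _]x4.
  transitivity ((x ^+ 2 - 1) * (x ^+ 2 - 'i ^+ 2)); first by ring.
  by rewrite sqrCi; ring.
by move/eqP; rewrite !mulf_eq0 !subr_eq0 -!orbA.
Qed.

Lemma unit4M (x y : C) : unit4 x -> unit4 y -> unit4 (x * y).
Proof.
by move=> /unit4P x4 /unit4P y4; apply/unit4P; rewrite exprMn x4 y4 mul1r.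
Qed.

Lemma unit4C (x : C) : unit4 x -> unit4 x^*.
Proof. by move=> /unit4P x4; apply/unit4P; rewrite -rmorphXn x4 rmorph1. Qed.

Lemma unit4_neq0 (x : C) : unit4 x -> x != 0.
Proof.
move=> /unit4P x4; apply/eqP => x0; move/eqP: x4.
by rewrite x0 expr0n eq_sym oner_eq0.
Qed.

Lemma unit4_norm (x : C) : unit4 x -> `|x| = 1.
Proof.
move=> /unit4P x4; apply/eqP; rewrite -(@pexpr_eq1 _ _ 4) //.
by rewrite -normrX x4 normr1.
Qed.

Lemma unit4_mulC (x : C) : unit4 x -> x * x^* = 1.
Proof. by move=> /unit4_norm x1; rewrite -normCK x1 expr1n. Qed.

(* The Schur complement of an edge of a graph with one positive eigenvalue,
   after rescaling the vertices x by units; (p x, q x) are the rescaled entries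
   of the row of x at the two ends of the edge. *)
Lemma rescaled_form (V : finType) (h : V -> V -> C) (a b : V) :
  hermitian_form h -> (forall x, h x x = 0) ->
  (forall x y, h x y = 0 \/ unit4 (h x y)) ->
  (forall x, exists y, h x y != 0) -> h a b != 0 ->
  (form_inertia h <= 1)%N ->
  exists (th p q : V -> C) (g : V -> V -> C),
   [/\ [/\ forall x, unit4 (th x), hermitian_form g,
         (forall x, g x x = 0) & (forall x y, g x y = 0 \/ unit4 (g x y))],
      forall x y, h x y = th x * (th y)^* * g x y,
      form_inertia (fun x y => g x y - (p x * q y + q x * (p y)^*)) = 0%N,
      forall x, [\/ p x = 0 /\ q x = 1, p x = 1 /\ q x = 0 | unit4 (p x) /\ q x = 1]
    & (p a = 0 /\ q a = 1) /\ (p b = 1 /\ q b = 0)].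
Proof.
move=> hh hxx hU hN ab le1.
have uab : unit4 (h a b) by case: (hU a b) ab => // ->; rewrite eqxx.
set w := h a b in uab.
have ww := unit4_mulC uab.
have := form_inertia_edge hh (hxx a) (hxx b) (unit4_norm uab).
set S := (fun x y => _) => Seq.
have S0 : form_inertia S = 0%N by apply/eqP; rewrite -leqn0; move: le1; rewrite Seq.
have hS : hermitian_form S.
  move=> x y; rewrite /S rmorphB rmorphD !rmorphM /= -!hh; ring.
pose th x := if h x b != 0 then h x b else h x a * w.
have thU x : unit4 (th x).
  rewrite /th; case: (hU x b) => [xb|]; last first.
    by move=> u; rewrite unit4_neq0.
  rewrite xb eqxx /=; case: (hU x a) => [xa|u]; last exact: unit4M.
  have [y /negP[]] := hN x; apply/eqP.
  have Sx0 : S x x = 0 by rewrite /S hxx xa xb; ring.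
  by have := form_NSD_row0 y hS S0 Sx0; rewrite /S xa xb !mul0r addr0 subr0.
have th1 x : th x * (th x)^* = 1 by apply: unit4_mulC.
pose q x := (h x b != 0)%:R : C.
pose p x := h x a * w * (th x)^*.
have hb x : h x b = th x * q x.
  by rewrite /th /q; case: eqP => [->|] /=; rewrite ?mulr0 ?mulr1.
have ha x : h x a = th x * w^* * p x.
  transitivity (h x a * (w * w^*) * (th x * (th x)^*)); last by rewrite /p; ring.
  by rewrite ww th1 !mulr1.
pose g x y := (th x)^* * th y * h x y.
have hg : hermitian_form g by move=> x y; rewrite /g !rmorphM /= conjCK -hh; ring.
have hgE x y : h x y = th x * (th y)^* * g x y.
  transitivity ((th x * (th x)^*) * (th y * (th y)^*) * h x y).
    by rewrite !th1 !mul1r.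
  by rewrite /g; ring.
have qC x : (q x)^* = q x by rewrite /q conjC_nat.
have haC x : (h x a)^* = (th x)^* * w * (p x)^*.
  by rewrite ha; move: (p x) => P; rewrite !rmorphM /= conjCK.
have hbC x : (h x b)^* = (th x)^* * q x by rewrite hb rmorphM /= qC.
exists th, p, q, g; split=> //.
- split => // [x|x y]; first by rewrite /g hxx mulr0.
  rewrite /g; case: (hU x y) => [->|u]; [left; rewrite mulr0 // | right].
  by rewrite !unit4M ?unit4C.
- apply/eqP; rewrite -leqn0 -S0.
  have -> : form_inertia (fun x y => g x y - (p x * q y + q x * (p y)^*))
     = form_inertia (fun x y => (th x)^* * ((th y)^*)^* * S x y).
    apply: eq_form_inertia => x y.
    rewrite /S [h b y]hh [h a y]hh [h b a]hh -/w haC hbC (ha x) (hb x) conjCK mulrBr.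
    rewrite -/(g x y); congr (_ - _).
    transitivity ((w * w^*) * (th x * (th x)^*) * (th y * (th y)^*)
                  * (p x * q y + q x * (p y)^*)).
      by rewrite !th1 ww !mul1r.
    ring.
  exact: (form_inertia_pull id (fun x => (th x)^*) hS).
- move=> x; case: (hU x b) => [xb|u].
    apply: Or32; rewrite /p /q /th xb eqxx; split => //=.
    apply: unit4_mulC; have := thU x; by rewrite /th xb eqxx.
  rewrite /p /q (unit4_neq0 u).
  case: (hU x a) => [->|u']; first by apply: Or31; rewrite !mul0r.
  by apply: Or33; rewrite !unit4M ?unit4C.
rewrite /p /q /th !hxx -/w (unit4_neq0 uab) !eqxx !mul0r /=; split=> //; split=> //.
by rewrite [h b a]hh -/w; apply: unit4_mulC; rewrite unit4M ?unit4C.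
Qed.

(** * Forms with one positive eigenvalue *)

Definition c3_entry (i j : 'I_3) : C :=
  if j == i + 1 then 'i else if i == j + 1 then - 'i else 0.

Lemma c3_diag i : c3_entry i i = 0.
Proof. by case: i => [[|[|[|//]]] i3]. Qed.
Lemma c3_01 : c3_entry 0 1 = 'i. Proof. by []. Qed.
Lemma c3_12 : c3_entry 1 2%:R = 'i. Proof. by []. Qed.
Lemma c3_20 : c3_entry 2%:R 0 = 'i. Proof. by []. Qed.
Lemma c3_10 : c3_entry 1 0 = - 'i. Proof. by []. Qed.
Lemma c3_21 : c3_entry 2%:R 1 = - 'i. Proof. by []. Qed.
Lemma c3_02 : c3_entry 0 2%:R = - 'i. Proof. by []. Qed.

Lemma mulCi_i : 'i * 'i = -1 :> C.
Proof. by rewrite -expr2 sqrCi. Qed.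

Lemma oppCi_neq : - 'i != 'i :> C.
Proof.
rewrite eq_sym -addr_eq0 -mulr2n mulrn_eq0 /=; exact: neq0Ci.
Qed.

Lemma two_neq0 : (1 + 1 : C) != 0.
Proof. by rewrite (_ : 1 + 1 = 2%:R) ?pnatr_eq0. Qed.

Lemma unit4_normsq (z : C) : z = 0 \/ unit4 z -> z * z^* = 0 \/ z * z^* = 1.
Proof.
case=> [->|/unit4_mulC]; last by right.
by left; rewrite mul0r.
Qed.

Lemma rescaled_cases (V : finType) (p q : V -> C) (g : V -> V -> C) :
  hermitian_form g -> (forall x, g x x = 0) ->
  (forall x y, g x y = 0 \/ unit4 (g x y)) ->
  form_inertia (fun x y => g x y - (p x * q y + q x * (p y)^*)) = 0%N ->
  (forall x, [\/ p x = 0 /\ q x = 1, p x = 1 /\ q x = 0 | unit4 (p x) /\ q x = 1]) ->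
  (exists2 t : C, t \in [:: 'i; - 'i] &
    [/\ forall x, [\/ p x = 0 /\ q x = 1, p x = 1 /\ q x = 0 | p x = t /\ q x = 1],
        exists x, p x = t
      & forall x y, g x y = p x * q y + q x * (p y)^*]) \/
  (forall x, [\/ p x = 0 /\ q x = 1, p x = 1 /\ q x = 0 | p x = 1 /\ q x = 1]).
Proof.
move=> hg gxx gU; set T := (fun x y => _) => T0 pq.
have qC x : (q x)^* = q x.
  by case: (pq x) => [[_ ->]|[_ ->]|[_ ->]]; rewrite ?conjC1 ?conjC0.
have hT : hermitian_form T.
  move=> x y; rewrite /T rmorphB rmorphD !rmorphM /= conjCK -hg !qC; ring.
have pN1 x : q x = 1 -> p x != -1.
  move=> qx; apply/eqP => px; have := form_NSD_diag x hT T0.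
  rewrite /T gxx px qx rmorphN /= conjC1 [X in X <= _](_ : _ = 2%:R); last by ring.
  by rewrite lern0.
have [/existsP[x0 x0t]|nt] := boolP [exists x, p x \in [:: 'i; - 'i]]; last first.
  right=> x; case: (pq x) => [?|?|[u qx]]; [exact: Or31|exact: Or32|apply: Or33].
  split=> //; move: u; rewrite /unit4 inE => /orP[/eqP//|].
  rewrite inE (negPf (pN1 _ qx)) /= => u.
  by case/negP: nt; apply/existsP; exists x.
left; set t := p x0 in x0t; exists t => //.
have tC : t^* = - t.
  by move: x0t; rewrite !inE => /orP[]/eqP->; rewrite ?rmorphN /= conjCi ?opprK.
have tt : t * t = -1.
  by move: x0t; rewrite !inE => /orP[]/eqP->; rewrite ?mulrNN -expr2 sqrCi.
have t0 : t != 0.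
  by apply/eqP=> t0; move/eqP: tt; rewrite t0 mul0r eq_sym oppr_eq0 oner_eq0.
have t1 : t != 1.
  apply/eqP=> t1; move/eqP: tt; rewrite t1 mul1r -addr_eq0.
  by rewrite (negPf two_neq0).
have q0 : q x0 = 1.
  by case: (pq x0) => [[/eqP]|[/eqP]|[]] //; rewrite -/t ?(negPf t0) ?(negPf t1).
have row x y : T x x = 0 -> g x y = p x * q y + q x * (p y)^*.
  by move=> xx; have /eqP := form_NSD_row0 y hT T0 xx; rewrite /T subr_eq0 => /eqP.
have T00 : T x0 x0 = 0 by rewrite /T gxx q0 -/t tC; ring.
have pqt x : [\/ p x = 0 /\ q x = 1, p x = 1 /\ q x = 0 | p x = t /\ q x = 1].
  case: (pq x) => [?|?|[u qx]]; [exact: Or31|exact: Or32|apply: Or33; split=> //].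
  have := gU x0 x; rewrite (row _ _ T00) q0 qx -/t mulr1 mul1r => /unit4_normsq.
  have [//|px] := eqVneq (p x) t.
  have {}px : p x = 1 \/ p x = - t.
    move: u; rewrite /unit4 inE => /orP[/eqP|]; first by left.
    rewrite inE (negPf (pN1 _ qx)) /= => u; right.
    by move: x0t u px; rewrite !inE => /orP[]/eqP-> /orP[]/eqP->;
      rewrite ?eqxx ?opprK.
  case: px => ->; rewrite rmorphD /= conjCK ?rmorphN ?conjC1 /= tC.
    rewrite (_ : _ * _ = 1 - t * t); last by ring.
    rewrite tt opprK; case=> /eqP; first by rewrite (negPf two_neq0).
    by rewrite -subr_eq0 addrK oner_eq0.
  rewrite (_ : _ * _ = - (t * t) *+ 4); last by ring.
  rewrite tt opprK; case=> /eqP; first by rewrite pnatr_eq0.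
  by rewrite -subr_eq0 (_ : 1 *+ 4 - 1 = 3%:R) ?pnatr_eq0 //; ring.
split=> // [|x y]; first by exists x0.
apply: row; rewrite /T gxx.
by case: (pqt x) => [[-> ->]|[-> ->]|[-> ->]]; rewrite ?conjC0 ?conjC1 ?tC; ring.
Qed.

Lemma rescaled_multipartite (V : finType) (p q : V -> C) (g : V -> V -> C) :
  hermitian_form g -> (forall x, g x x = 0) ->
  (forall x y, g x y = 0 \/ unit4 (g x y)) ->
  form_inertia (fun x y => g x y - (p x * q y + q x * (p y)^*)) = 0%N ->
  (forall x, [\/ p x = 0 /\ q x = 1, p x = 1 /\ q x = 0 | p x = 1 /\ q x = 1]) ->
  (forall x y, g x y = (g x y != 0)%:R) /\
  (forall x y z, g x y = 0 -> g y z = 0 -> g x z = 0).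
Proof.
move=> hg gxx gU; set T := (fun x y => _) => T0 pq.
have qC x : (q x)^* = q x.
  by case: (pq x) => [[_ ->]|[_ ->]|[_ ->]]; rewrite ?conjC1 ?conjC0.
have pC x : (p x)^* = p x.
  by case: (pq x) => [[-> _]|[-> _]|[-> _]]; rewrite ?conjC1 ?conjC0.
have hT : hermitian_form T.
  move=> x y; rewrite /T rmorphB rmorphD !rmorphM /= conjCK -hg !qC; ring.
have row x y : p x * q x = 0 -> g x y = p x * q y + q x * p y.
  move=> pqx; have xx : T x x = 0 by rewrite /T gxx pC [q x * _]mulrC pqx; ring.
  by have /eqP := form_NSD_row0 y hT T0 xx; rewrite /T pC subr_eq0 => /eqP.
have g0C x y : g x y = 0 -> g y x = 0 by move=> xy; rewrite hg xy conjC0.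
pose r x := p x = 1 /\ q x = 1.
have TR x y : r x -> r y -> T x y = g x y - 2%:R.
  by move=> [px qx] [py qy]; rewrite /T pC px qx py qy; ring.
have gR x y : r x -> r y -> g x y = 0 \/ g x y = 1.
  move=> rx ry; have := form_NSD3 x y y (T x y)^* 2%:R 0 hT T0.
  rewrite [T y x]hT conjC0 !mul0r !mulr0 !addr0 conjCK conjC_nat !TR // !gxx.
  rewrite !rmorphB /= conjC_nat.
  case: (gU x y) => [->|]; first by left.
  rewrite /unit4 !inE => /or4P[]/eqP->; first by right.
  - rewrite rmorphN /= conjC1 [X in X <= _](_ : _ = 10%:R); last by ring.
    by rewrite lern0.
  - rewrite conjCi [X in X <= _](_ : _ = - ('i ^+ 2) *+ 2); last by ring.
    by rewrite sqrCi opprK lern0.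
  - rewrite rmorphN /= conjCi [X in X <= _](_ : _ = - ('i ^+ 2) *+ 2); last by ring.
    by rewrite sqrCi opprK lern0.
have cls x : p x * q x = 0 \/ r x.
  by case: (pq x) => [[px qx]|[px qx]|]; [left|left|right];
    rewrite ?px ?qx ?mul0r ?mulr0.
have rN x y : r y -> p x * q x = 0 -> g x y <> 0.
  move=> [py qy] pqx; rewrite (row _ _ pqx) py qy.
  case: (pq x) pqx => [[-> ->]|[-> ->]|[-> ->]];
    rewrite !(mul0r, mulr0, mulr1, addr0, add0r) => _ /eqP;
    by rewrite ?oner_eq0 // (negPf two_neq0).
split=> [x y|x y z].
  suff [->|->] : g x y = 0 \/ g x y = 1 by rewrite ?eqxx ?oner_eq0.
  case: (cls x) => [pqx|rx]; last case: (cls y) => [pqy|ry]; last exact: gR.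
    rewrite (row _ _ pqx); case: (pq x) pqx => [[-> ->]|[-> ->]|[-> ->]];
      case: (pq y) => [[-> ->]|[-> ->]|[-> ->]];
      rewrite !(mul0r, mulr0, mulr1, addr0, add0r);
      by [left|right|move=> /eqP; rewrite oner_eq0].
  rewrite hg (row _ _ pqy); case: rx => -> ->;
    case: (pq y) pqy => [[-> ->]|[-> ->]|[-> ->]];
    rewrite !(mul0r, mulr0, mulr1, addr0, add0r) ?conjC0 ?conjC1;
    by [left|right|move=> /eqP; rewrite oner_eq0].
case: (cls x) => [pqx xy yz|rx xy yz].
  have pqy : p y * q y = 0.
    by case: (cls y) => // ry; case: (rN _ _ ry pqx).
  move: xy yz; rewrite !(row _ _ pqx) (row _ _ pqy).
  case: (pq x) pqx => [[-> ->]|[-> ->]|[-> ->]];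
    case: (pq y) pqy => [[-> ->]|[-> ->]|[-> ->]];
    rewrite !(mul0r, mulr0, mul1r, mulr1, addr0, add0r) => pqx pqy //;
    by move=> /eqP; rewrite oner_eq0.
have ry : r y by case: (cls y) => // pqy; case: (rN _ _ rx pqy); apply: g0C.
have rz : r z by case: (cls z) => // pqz; case: (rN _ _ ry pqz); apply: g0C.
case: (gR _ _ rx rz) => // xz.
have := form_NSD3 x y z 1 (- 2%:R) 1 hT T0.
rewrite !TR // !gxx xy yz xz (g0C _ _ xy) (g0C _ _ yz) [g z x]hg xz.
rewrite rmorphN /= conjC1 conjC_nat.
rewrite [X in X <= _](_ : _ = 2%:R); last by ring.
by rewrite lern0.
Qed.

Lemma single_positive_structure (V : finType) (h : V -> V -> C) (a b : V) :
  hermitian_form h -> (forall x, h x x = 0) ->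
  (forall x y, h x y = 0 \/ unit4 (h x y)) ->
  (forall x, exists y, h x y != 0) -> h a b != 0 ->
  (form_inertia h <= 1)%N ->
  exists2 th : V -> C, forall x, unit4 (th x) &
  (exists2 e : rel V, forall x y, h x y = th x * (th y)^* * (e x y)%:R
     & forall x y z, ~~ e x y -> ~~ e y z -> ~~ e x z) \/
  (exists2 c : V -> 'I_3, forall x y, h x y = th x * (th y)^* * c3_entry (c x) (c y)
     & forall i, exists x, c x = i).
Proof.
move=> hh hxx hU hN ab le1.
have [th [p [q [g [[thU hg gxx gU] hE T0 pq [[pa qa] [pb qb]]]]]]] :=
  rescaled_form hh hxx hU hN ab le1.
case: (rescaled_cases hg gxx gU T0 pq) => [[t tI [pqt [x0 px0] gE]]|pq1]; last first.
  have [g01 gtr] := rescaled_multipartite hg gxx gU T0 pq1.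
  exists th => //; left; exists (fun x y => g x y != 0) => [x y|x y z].
    by rewrite hE {1}g01.
  by rewrite !negbK => /eqP xy /eqP yz; rewrite (gtr _ _ _ xy yz).
have tC : t^* = - t.
  by move: tI; rewrite !inE => /orP[]/eqP->; rewrite ?rmorphN /= conjCi ?opprK.
have tt : t * t = -1.
  by move: tI; rewrite !inE => /orP[]/eqP->; rewrite ?mulrNN -expr2 sqrCi.
have t0 : t != 0.
  by apply/eqP=> t0; move/eqP: tt; rewrite t0 mul0r eq_sym oppr_eq0 oner_eq0.
have tU : unit4 t.
  by rewrite /unit4; move: tI; rewrite !inE => /orP[]->; rewrite ?orbT.
(* The rescaled weight of a directed triangle is t or its conjugate; the phases
   below spread it evenly over its three edges. *)
pose phi x := if q x == 0 then 1 else if p x == 0 then t else t^*.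
pose c x : 'I_3 := if q x == 0 then (if t == 'i then 0 else 1)
  else if p x == 0 then (if t == 'i then 1 else 0) else 2%:R.
have phiU x : unit4 (phi x).
  rewrite /phi; case: ifP => _; first by rewrite /unit4 inE eqxx.
  by case: ifP => _ //; apply: unit4C.
exists (fun x => th x * phi x) => [x|]; first exact: unit4M.
right; exists c => [x y|i].
  rewrite hE rmorphM /=.
  transitivity (th x * (th y)^* * (phi x * (phi y)^* * c3_entry (c x) (c y)));
    last by ring.
  congr (_ * _); rewrite gE /phi /c.
  case: (pqt x) => [[-> ->]|[-> ->]|[-> ->]];
    case: (pqt y) => [[-> ->]|[-> ->]|[-> ->]];
    rewrite ?eqxx ?oner_eq0 ?(negPf t0) ?c3_diag ?conjC0 ?conjC1 ?conjCK ?tC;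
    rewrite !(mul0r, mulr0, mul1r, mulr1, addr0, add0r, subrr) //;
    move: tI; rewrite !inE => /orP[]/eqP tE; rewrite tE ?eqxx ?(negPf oppCi_neq);
    rewrite ?c3_01 ?c3_12 ?c3_20 ?c3_10 ?c3_21 ?c3_02;
    rewrite ?(mulrN, mulNr) ?opprK -?mulrA ?mulCi_i ?mulrN1 ?opprK ?mulr1 //.
case: (pqt x0) => [[px qx]|[px qx]|[px qx]].
- by move: px; rewrite px0 => /eqP; rewrite (negPf t0).
- by move: tt; rewrite -px0 px mulr1 => /eqP; rewrite -addr_eq0 (negPf two_neq0).
case: i => [[|[|[|//]]] i3].
- exists (if t == 'i then b else a); apply/val_inj; rewrite /c /=.
  by case: (t == _); rewrite ?pa ?qa ?pb ?qb ?eqxx ?oner_eq0.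
- exists (if t == 'i then a else b); apply/val_inj; rewrite /c /=.
  by case: (t == _); rewrite ?pa ?qa ?pb ?qb ?eqxx ?oner_eq0.
by exists x0; apply/val_inj; rewrite /c /= qx px oner_eq0 (negPf t0).
Qed.

(** * Mixed graphs *)

Lemma adj_sym (V : finType) (G : mixed_graph V) x y : adj G x y = adj G y x.
Proof. exact: sadj_sym. Qed.

Lemma adj_irr (V : finType) (G : mixed_graph V) x : adj G x x = false.
Proof. exact: sadj_irr. Qed.

Lemma entry_herm (V : finType) (G : mixed_graph V) :
  hermitian_form (hermitian_entry C G).
Proof.
move=> x y; rewrite /hermitian_entry /undirected adj_sym [~~ arc G y x && _]andbC.
case: ifP => _; first by rewrite conjC1.
case xy: (arc G x y).
  by rewrite (negPf (arc_asym xy)) conjCi.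
case: (arc G y x); last by rewrite conjC0.
by rewrite rmorphN /= conjCi opprK.
Qed.

Lemma entry_neq0 (V : finType) (G : mixed_graph V) x y :
  (hermitian_entry C G x y != 0) = adj G x y.
Proof.
rewrite /hermitian_entry /undirected.
case xy: (arc G x y); first by rewrite andbF neq0Ci; rewrite /adj (arc_sub xy).
case yx: (arc G y x).
  by rewrite !andbF oppr_eq0 neq0Ci adj_sym /adj (arc_sub yx).
by rewrite !andbT; case: (adj G x y); rewrite ?oner_eq0 ?eqxx.
Qed.

Lemma entry_unit4 (V : finType) (G : mixed_graph V) x y :
  hermitian_entry C G x y = 0 \/ unit4 (hermitian_entry C G x y).
Proof.
rewrite /hermitian_entry /unit4 !inE.
case: ifP => _; first by right; rewrite eqxx.
case: ifP => _; first by right; rewrite eqxx !orbT.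
by case: ifP => _; [right; rewrite eqxx !orbT | left].
Qed.

Lemma entry_nadj (V : finType) (G : mixed_graph V) x y :
  ~~ adj G x y -> hermitian_entry C G x y = 0.
Proof. by rewrite -(entry_neq0 G x y) negbK => /eqP. Qed.

Lemma entry_diag (V : finType) (G : mixed_graph V) x : hermitian_entry C G x x = 0.
Proof. by apply: entry_nadj; rewrite adj_irr. Qed.

Lemma entry_adj (V : finType) (G : mixed_graph V) x y :
  adj G x y -> unit4 (hermitian_entry C G x y).
Proof.
by rewrite -(entry_neq0 G x y); case: (entry_unit4 G x y) => // ->; rewrite eqxx.
Qed.

Lemma entry_simple (V : finType) (K : simple_graph V) x y :
  hermitian_entry C K x y = (sadj K x y)%:R.
Proof.
by rewrite /hermitian_entry /undirected /adj /= !andbT; case: (sadj K x y).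
Qed.

Lemma eq_entry (V W : finType) (G : mixed_graph V) (F : mixed_graph W) x y x' y' :
  adj G x y = adj F x' y' -> arc G x y = arc F x' y' -> arc G y x = arc F y' x' ->
  hermitian_entry C G x y = hermitian_entry C F x' y'.
Proof. by rewrite /hermitian_entry /undirected => -> -> ->. Qed.

Lemma positive_inertia_edge (V : finType) (G : mixed_graph V) a b :
  adj G a b -> (0 < positive_inertia C G)%N.
Proof.
move=> ab; rewrite -[positive_inertia C G]/(form_inertia (hermitian_entry C G)).
by rewrite (form_inertia_edge (entry_herm G) (entry_diag G a) (entry_diag G b)
  (unit4_norm (entry_adj ab))).
Qed.

Lemma pendant_inertia (V : finType) (G : mixed_graph V) u c :
  (forall y, adj G u y = (y == c)) ->
  positive_inertia C G =
  (form_inertia (fun x y => if (x == c) || (y == c) then 0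
                            else hermitian_entry C G x y)).+1.
Proof.
move=> uc; have auc : adj G u c by rewrite uc.
have := form_inertia_edge (entry_herm G) (entry_diag G u) (entry_diag G c)
  (unit4_norm (entry_adj auc)).
rewrite -[form_inertia (hermitian_entry C G)]/(positive_inertia C G) => ->.
congr S; apply: eq_form_inertia => x y; set h := hermitian_entry C G.
have hu z : z != c -> h u z = 0 by move=> zc; apply: entry_nadj; rewrite uc.
have hu' z : z != c -> h z u = 0.
  by move=> zc; rewrite /h entry_herm -/h hu // conjC0.
have h1 : h u c * h c u = 1.
  by rewrite /h [X in _ * X]entry_herm unit4_mulC ?entry_adj.
have cc : h c c = 0 by apply: entry_diag.
have [->|xc] /= := eqVneq x c.
  by rewrite cc [h c u * _]mulrC h1; ring.
have [->|yc] := eqVneq y c.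
  by rewrite cc -[h x c * _ * _]mulrA [h c u * _]mulrC h1; ring.
by rewrite (hu' x) // (hu y) //; ring.
Qed.

Definition pull_simple (V W : finType) (f : W -> V) (G : simple_graph V) :=
  @SimpleGraph W (fun x y => sadj G (f x) (f y))
    (fun x y => sadj_sym G (f x) (f y)) (fun x => sadj_irr G (f x)).

Definition pull_graph (V W : finType) (f : W -> V) (G : mixed_graph V) :=
  @MixedGraph W (pull_simple f (underlying G)) (fun x y => arc G (f x) (f y))
    (fun x y => @arc_sub V G (f x) (f y)) (fun x y => @arc_asym V G (f x) (f y)).

Lemma switchingI (V : finType) (F K : mixed_graph V) (th : V -> C) :
  (forall x, unit4 (th x)) ->
  (forall x y,
     hermitian_entry C F x y = th x * (th y)^* * hermitian_entry C K x y) ->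
  switching_equivalent C F K.
Proof.
move=> thU FK; pose Q := diag_mx (\row_i th (@enum_val V V i)) : 'M[C]_#|V|.
pose Q' := diag_mx (\row_i (th (@enum_val V V i))^*) : 'M[C]_#|V|.
have QQ : Q' *m Q = 1%:M.
  rewrite mulmx_diag; apply/matrixP=> i j; rewrite !mxE mulrC.
  by rewrite unit4_mulC.
have QU : Q \in unitmx by have [] := mulmx1_unit QQ.
exists Q; split; first exact: diag_mx_is_diag.
  by move=> s; rewrite !mxE eqxx mulr1n; apply: thU.
left; have -> : invmx Q = Q' by rewrite -[LHS]mul1mx -QQ mulmxK.
rewrite mul_diag_mx mul_mx_diag; apply/matrixP=> i j; rewrite !mxE FK.
set x := enum_val i; set y := enum_val j.
transitivity ((th x * (th x)^*) * (th y * (th y)^*) * hermitian_entry C K x y).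
  by rewrite !unit4_mulC // !mul1r.
by ring.
Qed.

Lemma switching_inertia (V : finType) (F K : mixed_graph V) :
  switching_equivalent C F K -> positive_inertia C F = positive_inertia C K.
Proof.
case=> Q [/is_diag_mxP Qd QU QE].
pose A := hermitian_adj C F.
have hA : A^t* = A by apply: form_mx_herm; apply: entry_herm.
have QQ : Q *m Q^t* = 1%:M.
  apply/matrixP=> i j; rewrite !mxE (bigD1 i) //= big1 => [|k ki]; last first.
    by rewrite Qd ?mul0r // eq_sym.
  rewrite addr0 !mxE; case: eqP => [<-|/eqP ij].
    by rewrite unit4_mulC //; apply: QU.
  by rewrite (Qd j i) ?conjC0 ?mulr0 // eq_sym.
have [uQ _] := mulmx1_unit QQ.
have QV : invmx Q = Q^t* by rewrite -[LHS]mulmx1 -QQ mulKmx.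
have {}QE : inertia (hermitian_adj C K) = inertia (Q^t* *m A *m (Q^t*)^t*).
  by rewrite trmxCK -QV; case: QE => <-; rewrite ?inertia_trmx.
rewrite -[positive_inertia C F]/(inertia A).
rewrite -[positive_inertia C K]/(inertia (hermitian_adj C K)).
rewrite QE; apply/eqP; rewrite eqn_leq inertia_congr // andbT.
have {1}-> : A = Q *m (Q^t* *m A *m (Q^t*)^t*) *m Q^t*.
  by rewrite trmxCK !mulmxA QQ mul1mx -mulmxA QQ mulmx1.
by apply: inertia_congr; rewrite !trmxC_mul !trmxCK hA mulmxA.
Qed.

Lemma complete_inertia k :
  (form_inertia (fun i j : 'I_k => (i != j)%:R : C) <= 1)%N.
Proof.
set n := #|'I_k|; pose v := const_mx 1 : 'M[C]_(n, 1).
have -> : form_inertia (fun i j : 'I_k => (i != j)%:R : C)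
    = inertia (v *m 1%:M *m v^t* + diag_mx (const_mx (-1))).
  congr inertia; apply/matrixP=> i j; rewrite mulmx1 !mxE big_ord1 !mxE conjC1 mulr1.
  by rewrite (inj_eq enum_val_inj); case: eqP => _ /=;
    rewrite ?mulr1n ?subrr ?mulr0n ?addr0.
have h1 : (1%:M : 'M[C]_1)^t* = 1%:M by rewrite trmx1 map_mx1.
apply: leq_trans (inertiaD _ _) _.
- by rewrite !trmxC_mul trmxCK h1 mulmxA.
- rewrite tr_diag_mx map_diag_mx; congr diag_mx; apply/matrixP=> i j.
  by rewrite !mxE rmorphN /= conjC1.
rewrite -[leqRHS]addn0 leq_add //.
  by apply: leq_trans (inertia_congr _ h1) _; rewrite inertia_scalar ltr01.
rewrite inertia_diag leqn0; apply/eqP/eq_card0 => i.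
by rewrite inE mxE ltr0N1.
Qed.

Lemma multipartite_inertia (V : finType) (K : simple_graph V) :
  complete_multipartite K -> positive_inertia C K = 1%N.
Proof.
case=> k [part [k2 part_surj KE]]; apply/eqP; rewrite eqn_leq; apply/andP; split.
  apply: leq_trans (complete_inertia k).
  have hk : hermitian_form (fun i j : 'I_k => (i != j)%:R : C).
    by move=> i j; rewrite conjC_nat eq_sym.
  apply: leq_trans (form_inertia_pull part (fun=> 1) hk).
  apply: eq_leq; apply: eq_form_inertia => x y.
  by rewrite entry_simple KE conjC1 !mul1r.
have [x px] := part_surj (Ordinal (ltnW k2)).
have [y py] := part_surj (Ordinal k2).
by apply: (@positive_inertia_edge _ _ x y); rewrite /adj /= KE px py.
Qed.

Lemma c3_herm : hermitian_form (c3_entry).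
Proof.
move=> [[|[|[|//]]] i3] [[|[|[|//]]] j3]; rewrite /c3_entry /=;
by rewrite ?rmorphN /= ?conjCi ?opprK ?conjC0.
Qed.

Lemma c3_inertia : form_inertia (c3_entry) = 1%N.
Proof.
rewrite (form_inertia_edge (a := 0) (b := 1) c3_herm) ?c3_diag //; last first.
  by rewrite c3_01 normCi.
congr S; apply: (etrans _ (form_inertia0 _)); apply: eq_form_inertia.
have iii : 'i * 'i * 'i = - 'i :> C by rewrite mulCi_i mulN1r.
move=> [[|[|[|//]]] i3] [[|[|[|//]]] j3]; rewrite /c3_entry /=.
all: by rewrite !(mulrN, mulNr, mul0r, mulr0, opprK, oppr0, addr0, add0r, iii,
  subrr, addNr).
Qed.

Lemma directed_C3_inertia (V : finType) (K : mixed_graph V) t1 t2 t3 :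
  (0 < t1)%N -> (0 < t2)%N -> directed_C3 t1 t2 t3 K ->
  positive_inertia C K = 1%N.
Proof.
move=> t1_gt0 t2_gt0 [A [B [D [[cA cB _] [AB BD DA] cov arcE adjE]]]].
have inD x : (x \in D) = (x \notin A) && (x \notin B).
  have : x \in A :|: B :|: D by rewrite cov inE.
  rewrite !inE; case xA: (x \in A).
    by rewrite /= (disjointFl DA xA).
  by case xB: (x \in B) => //=; rewrite (disjointFr BD xB).
have nAB x : x \in A -> x \in B = false by move=> xA; rewrite (disjointFr AB xA).
pose c x : 'I_3 := if x \in A then 0 else if x \in B then 1 else 2%:R.
have KE x y : hermitian_entry C K x y = c3_entry (c x) (c y).
  rewrite /hermitian_entry /undirected adjE !arcE !inD /c.
  case xA: (x \in A); first rewrite (nAB _ xA); last case xB: (x \in B);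
  (case yA: (y \in A); first rewrite (nAB _ yA); last case yB: (y \in B)) => //=;
  by rewrite ?c3_diag ?c3_01 ?c3_12 ?c3_20 ?c3_10 ?c3_21 ?c3_02.
apply/eqP; rewrite eqn_leq; apply/andP; split.
  rewrite -c3_inertia; apply: leq_trans (form_inertia_pull c (fun=> 1) c3_herm).
  by apply: eq_leq; apply: eq_form_inertia => x y; rewrite KE conjC1 !mul1r.
have /card_gt0P[x xA] : (0 < #|A|)%N by rewrite cA.
have /card_gt0P[y yB] : (0 < #|B|)%N by rewrite cB.
by apply: (@positive_inertia_edge _ _ x y); rewrite adjE arcE xA yB.
Qed.

Lemma C3_sub (V : finType) (c : V -> 'I_3) x y :
  c y == c x + 1 -> c x != c y.
Proof. by move/eqP->; case: (c x) => [[|[|[|//]]] i3]. Qed.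

Lemma C3_asym (V : finType) (c : V -> 'I_3) x y :
  c y == c x + 1 -> ~~ (c x == c y + 1).
Proof. by move/eqP->; case: (c x) => [[|[|[|//]]] i3]. Qed.

Definition tripartite (V : finType) (c : V -> 'I_3) :=
  @SimpleGraph V (fun x y => c x != c y)
    (fun x y => congr1 negb (eq_sym (c x) (c y)))
    (fun x => congr1 negb (eqxx (c x))).

Definition C3_graph (V : finType) (c : V -> 'I_3) :=
  @MixedGraph V (tripartite c) (fun x y => c y == c x + 1)
    (@C3_sub V c) (@C3_asym V c).

Lemma C3_graph_entry (V : finType) (c : V -> 'I_3) x y :
  hermitian_entry C (C3_graph c) x y = c3_entry (c x) (c y).
Proof.
rewrite /hermitian_entry /undirected /adj /= /c3_entry.
by case: (c x) (c y) => [[|[|[|//]]] i3] [[|[|[|//]]] j3].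
Qed.

Lemma C3_graph_directed (V : finType) (c : V -> 'I_3) :
  (forall i, exists x, c x = i) ->
  exists t1 t2 t3,
    [/\ 0 < t1, 0 < t2 & 0 < t3]%N /\ directed_C3 t1 t2 t3 (C3_graph c).
Proof.
move=> csurj; pose P (i : 'I_3) := [set x | c x == i].
have Pgt0 i : (0 < #|P i|)%N.
  by have [x cx] := csurj i; apply/card_gt0P; exists x; rewrite inE cx.
have dis i j : i != j -> [disjoint P i & P j].
  move=> ij; rewrite disjoint_subset; apply/subsetP=> x; rewrite !inE => /eqP->.
  by [].
exists #|P 0|, #|P 1|, #|P 2%:R|; split=> //.
exists (P 0), (P 1), (P 2%:R); split=> //.
- by split; apply: dis.
- by apply/setP=> x; rewrite !inE; case: (c x) => [[|[|[|//]]] i3].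
- move=> x y; rewrite !inE /=.
  by case: (c x) (c y) => [[|[|[|//]]] i3] [[|[|[|//]]] j3].
move=> x y; rewrite /adj /=.
by case: (c x) (c y) => [[|[|[|//]]] i3] [[|[|[|//]]] j3].
Qed.

Lemma multipartiteI (V : finType) (K : simple_graph V) a b :
  sadj K a b -> (forall x y z, ~~ sadj K x y -> ~~ sadj K y z -> ~~ sadj K x z) ->
  complete_multipartite K.
Proof.
move=> ab tr.
pose rep x := odflt x [pick y | ~~ sadj K x y].
have repE x : ~~ sadj K x (rep x).
  by rewrite /rep; case: pickP => //= /(_ x); rewrite sadj_irr.
have repP x y : (rep x == rep y) = ~~ sadj K x y.
  apply/eqP/idP => [xy|xy].
    by apply: (tr _ _ _ (repE x)); rewrite xy sadj_sym.
  have -> : rep x = odflt y [pick z | ~~ sadj K x z].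
    by rewrite /rep; case: pickP => //= /(_ x); rewrite sadj_irr.
  congr odflt; apply: eq_pick => z; apply/idP/idP; last exact: tr.
  by apply: tr; rewrite sadj_sym.
pose T : finType := {y | y \in codom rep}.
pose cl x : T := Sub (rep x) (codom_f rep x).
exists #|T|, (fun x => enum_rank (cl x)); split.
- have : cl a != cl b by rewrite -val_eqE /= repP ab.
  move=> ne; rewrite (cardD1 (cl a)) (cardD1 (cl b)) !inE /=.
  by rewrite eq_sym ne.
- move=> j; case E: (enum_val j) => [y yr]; have /codomP[x yx] := yr.
  exists x; apply: enum_val_inj; rewrite enum_rankK E; apply: val_inj.
  by rewrite /= yx.
move=> x y; rewrite (inj_eq enum_rank_inj) -val_eqE /= repP.
by rewrite negbK.
Qed.

Lemma form_inertia_gt0 (V : finType) (h : V -> V -> C) :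
  (0 < form_inertia h)%N -> exists a b, h a b != 0.
Proof.
move=> h0; suff /existsP[a /existsP[b ab]] : [exists a, exists b, h a b != 0].
  by exists a, b.
apply: contraLR h0; rewrite negb_exists => /forallP h0.
rewrite -leqNgt -(form_inertia0 V); apply: eq_leq; apply: eq_form_inertia => a b.
by have := h0 a; rewrite negb_exists => /forallP/(_ b); rewrite negbK => /eqP.
Qed.

Lemma joined_inertia (V VS VF : finType) (G : mixed_graph V)
    (S : mixed_graph VS) (c : VS) (F : mixed_graph VF) :
  mixed_star S c -> joined_at G S c F -> (0 < positive_inertia C F)%N ->
  positive_inertia C G = (positive_inertia C F).+1.
Proof.
move=> [S2 SE] [f [[f' fK f'K] fS fF fSF]] F0.
have [t0 _] := form_inertia_gt0 F0.
have f_inj : injective f := can_inj fK.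
have [u uc] : exists u, u != c.
  apply/existsP; apply: contraLR S2; rewrite negb_exists => /forallP all_c.
  rewrite -ltnNge ltnS (leq_trans (subset_leq_card (B := pred1 c) _)) ?card1 //.
  by apply/subsetP=> x _; rewrite inE; have := all_c x; rewrite negbK.
have pend y : adj G (f (inl u)) y = (y == f (inl c)).
  rewrite -(f'K y); case: (f' y) => [s|t].
    rewrite (proj1 (fS u s)) SE (negPf uc) (inj_eq f_inj) /=.
    rewrite [inl s == inl c]/eq_op /=.
    by case: (eqVneq s c) => [->|_]; rewrite ?uc ?andbF.
  rewrite (inj_eq f_inj) [inr t == inl c]/eq_op /=.
  by apply/negP=> /fSF uc'; rewrite uc' eqxx in uc.
rewrite (pendant_inertia pend); congr _.+1.
set h' := (fun x y => _).
have h'E x y : h' (f (inr x)) (f (inr y)) = hermitian_entry C F x y.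
  rewrite /h' !(inj_eq f_inj) /=.
  by have [a1 a2] := fF x y; have [_ a3] := fF y x; apply: eq_entry.
have hh' : hermitian_form h'.
  by move=> x y; rewrite /h' orbC; case: ifP; rewrite ?conjC0 // entry_herm.
have h'0 s y : h' (f (inl s)) y = 0.
  rewrite /h'; case: eqP => //= sc; case: eqP => //= yc; apply: entry_nadj.
  have {}sc : s != c by apply/eqP=> sc'; apply: sc; rewrite sc'.
  move: yc; rewrite -(f'K y); case: (f' y) => [s'|t] yc.
    rewrite (proj1 (fS s s')) SE (negPf sc) /=.
    by case: (eqVneq s' c) => [s'c|_]; [case: yc; rewrite s'c | rewrite andbF].
  by apply/negP=> /fSF sc'; rewrite sc' eqxx in sc.
pose g x := if f' x is inr t then t else t0.
pose d x : C := if f' x is inr t then 1 else 0.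
apply/eqP; rewrite eqn_leq; apply/andP; split.
  apply: leq_trans (form_inertia_pull g d (entry_herm F)).
  apply: eq_leq; apply: eq_form_inertia => x y.
  rewrite -{1}(f'K x) -{1}(f'K y) /g /d.
  case: (f' x) => [s|t]; first by rewrite h'0 !mul0r.
  case: (f' y) => [s'|t']; first by rewrite hh' h'0 conjC0 mulr0 mul0r.
  by rewrite h'E conjC1 !mul1r.
apply: leq_trans (form_inertia_pull (fun x => f (inr x)) (fun=> 1) hh').
by apply: eq_leq; apply: eq_form_inertia => x y; rewrite h'E conjC1 !mul1r.
Qed.

Lemma connected_neighbor (V : finType) (G : mixed_graph V) x y :
  connected_graph G -> x != y -> exists z, adj G x z.
Proof.
move=> /(_ x y) /connectP[[|z p] /= xp ->]; first by rewrite eqxx.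
by move=> _; exists z; case/andP: xp.
Qed.

Lemma pendant_decomposition (V : finType) (G : mixed_graph V) :
  connected_graph G -> (exists u, pendant G u) -> positive_inertia C G = 2%N ->
  exists (VS VF : finType) (S : mixed_graph VS) (c : VS) (F : mixed_graph VF),
    [/\ mixed_star S c, joined_at G S c F,
        forall x, exists y, adj F x y, (0 < #|VF|)%N
      & (positive_inertia C F <= 1)%N].
Proof.
move=> Gc [u /eqP/cards1P[c ucE]] G2.
have uc y : adj G u y = (y == c) by move/setP/(_ y): ucE; rewrite !inE.
have unc : u != c by apply/eqP=> unc; have := uc c; rewrite -{1}unc adj_irr eqxx.
move: G2; rewrite (pendant_inertia uc); set h' := (fun x y => _) => -[h'1].
pose N x := [exists y, [&& x != c, y != c & adj G x y]].
have Nc : N c = false by apply/existsP=> -[y]; rewrite eqxx.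
have Nu : N u = false by apply/existsP=> -[y]; rewrite uc => /and3P[_ /negP].
pose VS : finType := {x | ~~ N x}; pose VF : finType := {x | N x}.
have nNc : ~~ N c by rewrite Nc.
have nNu : ~~ N u by rewrite Nu.
pose cS : VS := Sub c nNc; pose uS : VS := Sub u nNu.
have adjS (x y : V) : ~~ N x -> x != c -> y != c -> adj G x y = false.
  move=> /existsPn/(_ y) + xc yc; rewrite xc yc /=; exact: negbTE.
exists VS, VF, (pull_graph (@sval V _) G), cS, (pull_graph (@sval V _) G).
split.
- split.
    by rewrite (cardD1 cS) (cardD1 uS) !inE /= -val_eqE /= unc.
  move=> x y; change (adj G (sval x) (sval y) =
    (sval x != sval y) && ((sval x == c) || (sval y == c))).
  have starc (z : VS) : sval z != c -> adj G (sval z) c.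
    move=> zc; have [v zv] := connected_neighbor Gc zc.
    by case: (eqVneq v c) zv => [->//|vc]; rewrite adjS //; apply: (valP z).
  case: (eqVneq (sval x) c) => [->|xc].
    case: (eqVneq c (sval y)) => [<-|yc] /=; first by rewrite adj_irr.
    by rewrite adj_sym starc // eq_sym.
  case: (eqVneq (sval y) c) => [->|yc] /=; first by rewrite starc // xc.
  by rewrite andbF adjS //; apply: (valP x).
- pose f (z : VS + VF) : V := match z with inl x => sval x | inr x => sval x end.
  exists f; split=> //.
  - pose f' x : VS + VF := if insub x is Some z then inr z else inl (insubd cS x).
    exists f' => [[z|z]|x]; rewrite /f' /f.
    + by rewrite insubN ?valKd //; apply: (valP z).
    + by rewrite valK.
    case: insubP => [z Nx <- //|nNx].
    by rewrite -[RHS](insubdK cS nNx).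
  - move=> [x Nx] [y Ny] /= xy; apply: val_inj => /=.
    have [//|xc] := eqVneq x c; move: xy; rewrite adjS //.
    by apply/eqP=> yc; rewrite yc Nc in Ny.
- move=> [x Nx]; have /existsP[y /and3P[xc yc xy]] := Nx.
  have Ny : N y by apply/existsP; exists x; rewrite xc yc adj_sym.
  by exists (Sub y Ny).
- have [|a [b]] := @form_inertia_gt0 _ h'; first by rewrite h'1.
  rewrite /h'; case: ifP => [|/norP[ac bc]]; first by rewrite eqxx.
  rewrite entry_neq0 => ab.
  have Na : N a by apply/existsP; exists b; rewrite ac bc.
  by apply/card_gt0P; exists (Sub a Na).
have hh' : hermitian_form h'.
  by move=> x y; rewrite /h' orbC; case: ifP; rewrite ?conjC0 // entry_herm.
rewrite -h'1; apply: leq_trans (form_inertia_pull (@sval V N) (fun=> 1) hh').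
apply: eq_leq; apply: eq_form_inertia => -[x Nx] [y Ny].
rewrite conjC1 !mul1r /h' /=.
have xc : x != c by apply/eqP=> xc; rewrite xc Nc in Nx.
have yc : y != c by apply/eqP=> yc; rewrite yc Nc in Ny.
by rewrite (negPf xc) (negPf yc).
Qed.

Lemma single_positive_switching (V : finType) (F : mixed_graph V) :
  (forall x, exists y, adj F x y) -> (0 < #|V|)%N ->
  (positive_inertia C F <= 1)%N ->
  (exists K : simple_graph V,
     complete_multipartite K /\ switching_equivalent C F (mixed_of_simple K)) \/
  (exists (t1 t2 t3 : nat) (K : mixed_graph V),
     [/\ [/\ 0 < t1, 0 < t2 & 0 < t3]%N, directed_C3 t1 t2 t3 K
       & switching_equivalent C F K]).
Proof.
move=> Fn /card_gt0P[a _] F1; have [b ab] := Fn a.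
have hN x : exists y, hermitian_entry C F x y != 0.
  by have [y xy] := Fn x; exists y; rewrite entry_neq0.
have hab : hermitian_entry C F a b != 0 by rewrite entry_neq0.
have [th thU [[e hE etr]|[c hE csurj]]] := single_positive_structure
  (entry_herm F) (@entry_diag V F) (entry_unit4 F) hN hab F1.
  have eE x y : e x y = adj F x y.
    rewrite -entry_neq0 hE !mulf_eq0 conjC_eq0 !(negPf (unit4_neq0 (thU _))) /=.
    by case: (e x y); rewrite ?oner_eq0 ?eqxx.
  have esym : symmetric e by move=> x y; rewrite !eE adj_sym.
  have eirr : irreflexive e by move=> x; rewrite eE adj_irr.
  left; exists (SimpleGraph esym eirr); split.
    by apply: (@multipartiteI _ _ a b) => //=; rewrite eE.
  by apply: switchingI thU _ => x y; rewrite hE entry_simple.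
have [t1 [t2 [t3 [tpos tC3]]]] := C3_graph_directed csurj.
right; exists t1, t2, t3, (C3_graph c); split=> //.
by apply: switchingI thU _ => x y; rewrite hE C3_graph_entry.
Qed.

End PositiveInertia.

Theorem theorem1p1 (C : numClosedFieldType) (V : finType) (G : mixed_graph V)
    (G_connected : connected_graph G)
    (G_pendant : exists u : V, pendant G u) :
  positive_inertia C G = 2 <->
  exists (VS VF : finType) (S : mixed_graph VS) (c : VS) (F : mixed_graph VF),
    [/\ mixed_star S c,
        joined_at G S c F
      & (exists K : simple_graph VF,
           complete_multipartite K /\
           switching_equivalent C F (mixed_of_simple K))
     \/ (exists (t1 t2 t3 : nat) (K : mixed_graph VF),
           [/\ [/\ 0 < t1, 0 < t2 & 0 < t3],
               directed_C3 t1 t2 t3 K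
             & switching_equivalent C F K])].
Proof.
split=> [G2|[VS [VF [S [c [F [Sstar GSF FK]]]]]]].
  have [VS [VF [S [c [F [Sstar GSF Fn VF0 F1]]]]]] :=
    pendant_decomposition G_connected G_pendant G2.
  by exists VS, VF, S, c, F; split=> //; apply: single_positive_switching.
suff F1 : positive_inertia C F = 1 by rewrite (joined_inertia Sstar GSF) F1.
case: FK => [[K [Kmp FK]]|[t1 [t2 [t3 [K [[t1_gt0 t2_gt0 _] KC3 FK]]]]]].
  by rewrite (switching_inertia FK) multipartite_inertia.
by rewrite (switching_inertia FK) (directed_C3_inertia C t1_gt0 t2_gt0 KC3).
Qed.
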